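(* Let $\mathbb{A}$ be a Taylor algebra. If $\mathbb{A}$ is supernilpotent, then $\mathbb{A}$ is nilpotent.
   Context: An algebra $\mathbb{A}$ is a nonempty set $A$ with finitary basic operations; $\mathrm{Con}(\mathbb{A})$ is its congruence lattice, with least element $0$ and greatest element $1$. Taylor algebra: $\mathbb{A}$ has an idempotent term $t$ (i.e. $t(x,\dots,x)\approx x$) of some arity $s$ such that for each $e\in\{0,\dots,s-1\}$ the algebra satisfies an identity $t(z_{e,0},\dots,z_{e,s-1})\approx t(w_{e,0},\dots,w_{e,s-1})$ with all $z_{e,j},w_{e,j}\in\{x,y\}$ and $z_{e,e}=x$, $w_{e,e}=y$, where $x,y$ are distinct variables. Cubes: identify $n$ with $\{0,\dots,n-1\}$. For $\gamma\in A^{2^n}$, where $2^n$ is the set of functions $f:n\to\{0,1\}$, write $\gamma_f$ for its value at $f$. For $i\in n$ and $x,y\in A$, $\mathrm{cube}_i(x,y)\in A^{2^n}$ has value $x$ at $f$ if $f_i=0$ and value $y$ if $f_i=1$. For $i\in n$ and $g\in 2^{n\setminus\{i\}}$, the $(i)$-cross-section line of $\gamma$ at $g$ is the pair $\langle \gamma_{g\cup\{(i,0)\}},\gamma_{g\cup\{(i,1)\}}\rangle$. Algebra of matrices: for $n\ge 2$ and $\theta_0,\dots,\theta_{n-1}\in\mathrm{Con}(\mathbb{A})$, $M(\theta_0,\dots,\theta_{n-1})$ is the subalgebra of $\mathbb{A}^{2^n}$ generated by $\bigcup_{i\in n}\{\mathrm{cube}_i(x,y):\langle x,y\rangle\in\theta_i\}$.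 Centrality: for $\delta\in\mathrm{Con}(\mathbb{A})$ and $i\in n$, a relation $R\subseteq A^{2^n}$ has $(\delta,i)$-centrality if there is no $\gamma\in R$ such that exactly $2^{n-1}-1$ of its $2^{n-1}$ $(i)$-cross-section lines (indexed by $g\in 2^{n\setminus\{i\}}$) belong to $\delta$. Term condition commutator: $[\theta_0,\dots,\theta_{n-1}]_{TC}=\bigwedge\{\delta\in\mathrm{Con}(\mathbb{A}): M(\theta_0,\dots,\theta_{n-1})\text{ has }(\delta,n-1)\text{-centrality}\}$. Nilpotence: for $\theta\in\mathrm{Con}(\mathbb{A})$ put $(\theta]_0=\theta$ and $(\theta]_{k+1}=[\theta,(\theta]_k]_{TC}$. The congruence $\theta$ is (left) nilpotent if $(\theta]_k=0$ for some $k$. The congruence $\theta$ is supernilpotent if $[\theta,\dots,\theta]_{TC}=0$ for some number $\ge 2$ of arguments $\theta$. The algebra $\mathbb{A}$ is nilpotent (resp. supernilpotent) if its greatest congruence $1$ is. *)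

(* Defs.v *)
From mathcomp Require Import all_boot.
From mathcomp Require Import boolp classical_sets.

Set Implicit Arguments.
Unset Strict Implicit.
Unset Printing Implicit Defensive.

Local Open Scope classical_set_scope.

Record signature := Signature {
  symbol :> Type;
  arity : symbol -> nat
}.

Record algebra (S : signature) := Algebra {
  carrier :> Type;
  carrier_inhabited : inhabited carrier;
  op : forall s : S, ('I_(arity s) -> carrier) -> carrier
}.

Arguments op {S} a s _.

Section Terms.
Variable S : signature.

Inductive term (V : Type) : Type :=
| Var of V
| App (s : S) of ('I_(arity s) -> term V).

Fixpoint eval (A : algebra S) (V : Type) (v : V -> A) (t : term V) : A :=
  match t with
  | Var x => v x
  | App s ts => op A s (fun i => eval v (ts i))
  end.

(* The two variables x and y of an identity are encoded as [false] and [true];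
   [v : bool -> A] assigns values to them, and [v \o z] is the resulting tuple
   of arguments for the pattern [z] of variables. *)
Definition taylor (A : algebra S) : Prop :=
  exists (n : nat) (t : term 'I_n),
    (forall x : A, eval (fun=> x) t = x) /\
    (forall e : 'I_n, exists z w : 'I_n -> bool,
       [/\ z e = false, w e = true &
           forall v : bool -> A, eval (v \o z) t = eval (v \o w) t]).

End Terms.

Section Algebras.
Variable S : signature.

Definition subuniverse (A : algebra S) (B : set A) : Prop :=
  forall (s : S) (a : 'I_(arity s) -> A), (forall i, B (a i)) -> B (op A s a).

Definition generated (A : algebra S) (X : set A) : set A :=
  smallest (@subuniverse A) X.

Lemma power_inhabited (A : algebra S) (I : Type) : inhabited (I -> A).
Proof. by case: (carrier_inhabited A) => a; constructor. Qed.

Definition power (A : algebra S) (I : Type) : algebra S :=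
  @Algebra S (I -> A) (power_inhabited A I)
    (fun s a i => op A s (fun k => a k i)).

Record congruence (A : algebra S) := Congruence {
  con_rel :> A -> A -> Prop;
  con_refl : forall x, con_rel x x;
  con_sym : forall x y, con_rel x y -> con_rel y x;
  con_trans : forall x y z, con_rel x y -> con_rel y z -> con_rel x z;
  con_compat : forall (s : S) (a b : 'I_(arity s) -> A),
    (forall i, con_rel (a i) (b i)) -> con_rel (op A s a) (op A s b)
}.

Lemma con_ext (A : algebra S) (c d : congruence A) :
  (forall x y, c x y <-> d x y) -> c = d.
Proof.
case: c => c cr cs ct cc; case: d => d dr ds dt dc /= E.
have {}E : c = d by apply/funext => x; apply/funext => y; apply/propext.
rewrite E in cr cs ct cc *.
by congr Congruence; exact: Prop_irrelevance.
Qed.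

Section Lattice.
Variable A : algebra S.

Definition con0 : congruence A.
Proof.
refine (@Congruence A (fun x y => x = y) _ _ _ _) => //.
- by move=> x y z -> ->.
- by move=> s a b ab; congr (op A s _); apply/funext.
Defined.

Definition con1 : congruence A.
Proof. by refine (@Congruence A (fun _ _ => True) _ _ _ _). Defined.

Definition con_inf (D : set (congruence A)) : congruence A.
Proof.
refine (@Congruence A (fun x y => forall d, D d -> d x y) _ _ _ _).
- by move=> x d _; exact: con_refl.
- by move=> x y xy d Dd; apply: con_sym; exact: xy.
- by move=> x y z xy yz d Dd; apply: con_trans (xy d Dd) (yz d Dd).
- by move=> s a b ab d Dd; apply: con_compat => i; exact: ab.
Defined.

Definition con_le (c d : congruence A) : Prop := forall x y, c x y -> d x y.

Lemma con0_least c : con_le con0 c.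
Proof. by move=> x y /= ->; exact: con_refl. Qed.

Lemma con1_greatest c : con_le c con1.
Proof. by []. Qed.

Lemma con_inf_glb (D : set (congruence A)) c :
  con_le c (con_inf D) <-> forall d, D d -> con_le c d.
Proof.
split=> [cD d Dd x y /cD|cD x y cxy d Dd]; first exact.
exact: cD cxy.
Qed.

End Lattice.

Section Commutator.
Variable A : algebra S.

Definition vertex (n : nat) := {ffun 'I_n -> bool}.

Definition cube (n : nat) (i : 'I_n) (x y : A) : power A (vertex n) :=
  fun f => if f i then y else x.

Definition matrices (n : nat) (theta : 'I_n -> congruence A) :
    set (power A (vertex n)) :=
  generated (\bigcup_(i in [set: 'I_n])
    [set gamma | exists x y : A, theta i x y /\ gamma = cube i x y]).

(* Elements of 2^(n \ {i}), indexing the (i)-cross-section lines *)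
Definition line_index (n : nat) (i : 'I_n) :=
  {ffun {j : 'I_n | j != i} -> bool}.

(* g \cup {(i, b)}: [insub j] is [None] exactly when j = i. *)
Definition extend (n : nat) (i : 'I_n) (g : line_index i) (b : bool) :
    vertex n :=
  [ffun j => if (insub j : option {j : 'I_n | j != i}) is Some k
             then g k else b].

Definition line_in (n : nat) (i : 'I_n) (delta : congruence A)
    (gamma : power A (vertex n)) (g : line_index i) : Prop :=
  delta (gamma (extend g false)) (gamma (extend g true)).

Definition centrality (n : nat) (R : set (power A (vertex n)))
    (delta : congruence A) (i : 'I_n) : Prop :=
  ~ exists gamma, R gamma /\
      #|[pred g : line_index i | `[< line_in delta gamma g >]]|
        = (2 ^ (n - 1) - 1)%N.

Definition tc_commutator (m : nat) (theta : 'I_m.+2 -> congruence A) :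
    congruence A :=
  con_inf [set delta | centrality (matrices theta) delta ord_max].

Definition tc_commutator2 (alpha beta : congruence A) : congruence A :=
  tc_commutator (fun i : 'I_2 => if i == ord0 then alpha else beta).

Fixpoint left_series (theta : congruence A) (k : nat) : congruence A :=
  if k is l.+1 then tc_commutator2 theta (left_series theta l) else theta.

Definition con_nilpotent (theta : congruence A) : Prop :=
  exists k, left_series theta k = con0 A.

Definition con_supernilpotent (theta : congruence A) : Prop :=
  exists m : nat, tc_commutator (fun _ : 'I_m.+2 => theta) = con0 A.

End Commutator.

Definition nilpotent (A : algebra S) : Prop := con_nilpotent (con1 A).

Definition supernilpotent (A : algebra S) : Prop :=
  con_supernilpotent (con1 A).

End Algebras.

(* Main.v *)
(* Let M be the algebra of n-dimensional matrices M(1, ..., 1), and let Delta be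
   its closure under relational composition in all n directions.  Nilpotence
   follows from two facts.
   (1) For k <= n, the pairs (x, y) for which Delta contains the cube with value
   y where f_0 = ... = f_(k-1) = 1 and x elsewhere form a congruence delta_k, and
   [1, delta_k] <= delta_(k+1); hence (1]_n <= delta_n.
   (2) If M has (0, n-1)-centrality, then so has Delta, and hence delta_n = 0.
   In (2), let r0, r1, r2 be the successive faces of a composition in direction
   k, where r0 and r2 agree except at one vertex, with values b and c there.  An
   identity t(z) = t(w) with z_e = x, w_e = y gives a one-step link from
   t(z(r0, r1)) = t(w(r0, r1)) to t(z(r0, r1)) with r2 in place of r0 at e, so by
   centrality t(u_0, .., b, .., u_(s-1)) = t(u_0, .., c, .., u_(s-1)) for some
   tuple u.  This applies as well to the images of b and c under any polynomial
   obtained by nesting t.  Nesting n-1 times, with one direction of the cube for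
   each level, M-centrality replaces the particular tuples u by arbitrary ones,
   and then idempotence of the nested term gives b = c. *)

From mathcomp Require Import all_boot fingroup.perm.
From mathcomp Require Import boolp classical_sets.
Require Import Defs.

Set Implicit Arguments.
Unset Strict Implicit.
Unset Printing Implicit Defensive.

Local Open Scope classical_set_scope.

(** * Terms in subuniverses and powers *)

Section Evaluation.
Variables (S : signature) (A : algebra S).

Lemma subuniverse_eval (B : set A) (V : Type) (v : V -> A) (t : term S V) :
  subuniverse B -> (forall x, B (v x)) -> B (eval v t).
Proof. by move=> sB Bv; elim: t => [x|s ts IH] //=; apply: sB. Qed.

Lemma eval_power (I V : Type) (v : V -> power A I) (t : term S V) (i : I) :
  eval v t i = eval (fun x => v x i) t.
Proof.
elim: t => [x|s ts IH] //=; congr (op A s _); apply/funext => k; exact: IH.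
Qed.

Lemma generated_sub (X B : set A) :
  subuniverse B -> X `<=` B -> generated X `<=` B.
Proof. by move=> sB XB a Ha; exact: (Ha B). Qed.

Lemma sub_generated (X : set A) : X `<=` generated X.
Proof. by move=> a Xa B [_ XB]; exact: XB. Qed.

Lemma generated_subuniverse (X : set A) : subuniverse (generated X).
Proof. by move=> s a Ha B XB; apply: (XB.1) => i; exact: (Ha i B). Qed.

End Evaluation.

(** * Unary polynomials obtained by nesting an idempotent term *)

Section Substitution.
Variables (S : signature) (A : algebra S) (s : nat) (t : term S 'I_s).

Definition plug (w : 'I_s -> A) (e : 'I_s) (x : A) : 'I_s -> A :=
  fun i => if i == e then x else w i.

(** Hybrid argument: [h j] has c in its first j entries and b in the others. *)
Lemma one_at_a_time (T : Type) (F : ('I_s -> A) -> T) (b c : A) :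
  (forall e w, F (plug w e b) = F (plug w e c)) -> F (fun=> b) = F (fun=> c).
Proof.
move=> Fbc; pose h j : 'I_s -> A := fun i => if i < j then c else b.
have H j : j <= s -> F (h 0) = F (h j).
  elim: j => // j IH js; rewrite IH 1?ltnW //.
  have -> : h j = plug (h j) (Ordinal js) b.
    by apply/funext => i; rewrite /plug /h; case: (i =P _) => // ->; rewrite /= ltnn.
  rewrite Fbc; congr F; apply/funext => i.
  by rewrite /plug /h -val_eqE /= ltnS (leq_eqVlt i j); case: (val i =P j).
have -> : (fun=> c) = h s by apply/funext => i; rewrite /h ltn_ord.
by rewrite -H.
Qed.

Definition translation (e : 'I_s) (w : 'I_s -> A) (x : A) : A :=
  eval (plug w e x) t.

Definition translations (l : seq ('I_s * ('I_s -> A))) (x : A) : A :=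
  foldr (fun p => translation p.1 p.2) x l.

Hypothesis t_idem : forall x : A, eval (fun=> x) t = x.

(** By idempotence b = t(b, .., b) and c = t(c, .., c); exchanging the entries one at a time uses
    chains that are one step longer, the new step being innermost. *)
Lemma translations_separate (m : nat) (b c : A) :
  (forall l, size l = m -> translations l b = translations l c) -> b = c.
Proof.
elim: m => [|m IH] H; first exact: (H [::]).
apply: IH => l lm; rewrite -(t_idem b) -[in RHS](t_idem c).
apply: (one_at_a_time (F := fun u => translations l (eval u t))) => e w.
have := H (rcons l (e, w)); rewrite size_rcons lm => /(_ erefl).
by rewrite /translations !foldr_rcons.
Qed.

End Substitution.

(** * Vertices of the cube and changes of one coordinate *)

Section Vertices.
Variable n : nat.
Implicit Types (f v : vertex n) (i j k : 'I_n) (b c : bool).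

Definition upd k b f : vertex n := [ffun i => if i == k then b else f i].

Lemma updE k b f i : upd k b f i = if i == k then b else f i.
Proof. by rewrite ffunE. Qed.

Lemma upd_same k b f : upd k b f k = b.
Proof. by rewrite updE eqxx. Qed.

Lemma upd_upd k b c f : upd k b (upd k c f) = upd k b f.
Proof. by apply/ffunP => i; rewrite !updE; case: eqP. Qed.

Lemma upd_id k f : upd k (f k) f = f.
Proof. by apply/ffunP => i; rewrite updE; case: eqP => // ->. Qed.

Lemma updC i k b c f : i != k -> upd i b (upd k c f) = upd k c (upd i b f).
Proof.
move=> ik; apply/ffunP => j; rewrite !updE.
by case: (eqVneq j i) => // ->; rewrite (negPf ik).
Qed.

Definition off k v f := exists2 j, j != k & f j != v j.

Definition all_below (m : nat) f := [forall i : 'I_n, (i < m) ==> f i].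

Lemma all_below0 f : all_below 0 f.
Proof. by apply/forallP. Qed.

Lemma all_belowS k f : all_below k.+1 f = all_below k f && f k.
Proof.
apply/forallP/andP => [H|[/forallP H fk] i].
  split; last by have := H k; rewrite ltnSn.
  by apply/forallP => i; apply/implyP => ik; apply: (implyP (H i)); apply: ltnW.
rewrite ltnS leq_eqVlt val_eqE; case: eqP => [->|_] //=; exact: H.
Qed.

Lemma all_below_upd k m b f : m <= k -> all_below m (upd k b f) = all_below m f.
Proof.
move=> mk; apply: eq_forallb => i; rewrite updE; case: eqP => // ->.
by rewrite ltnNge mk.
Qed.

Lemma all_below_weak m p f : m <= p -> all_below p f -> all_below m f.
Proof.
move=> mp /forallP H; apply/forallP => i; apply/implyP => im.
by apply: (implyP (H i)); apply: leq_trans mp.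
Qed.

End Vertices.

(** * Centrality as absence of a single exceptional line *)

Section Centrality.
Variables (S : signature) (A : algebra S) (n : nat).

Lemma card_line_index (i : 'I_n) : #|{: line_index i}| = 2 ^ (n - 1).
Proof.
by rewrite card_ffun card_bool card_sig cardC1 card_ord subn1.
Qed.

Lemma centralityP (R : set (power A (vertex n))) (d : congruence A) i :
  centrality R d i <->
  forall gamma g0, R gamma -> (forall g, g != g0 -> line_in d gamma g) ->
    line_in d gamma (g0 : line_index i).
Proof.
split=> [H gamma g0 Rg Hg|H [gamma [Rg]]].
  apply: contrapT => N; apply: H; exists gamma; split=> //.
  have := cardC1 g0; rewrite (card_line_index i) -subn1 => <-.
  apply: eq_card => g; rewrite !inE.
  by case: (eqVneq g g0) => [->|gg]; [exact/asboolP|apply/asboolP]; exact: Hg.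
set P := [pred g | _] => cP.
have : #|predC P| = 1.
  have := cardC P; rewrite cP (card_line_index i).
  have : 0 < 2 ^ (n - 1) by rewrite expn_gt0.
  by case: (2 ^ (n - 1)) => // p _; rewrite subn1 /= -addn1 => /addnI.
move=> /mem_card1 [g0 E]; have := E g0; rewrite !inE eqxx => /negP; apply.
apply/asboolP; apply: H => // g gg; have := E g; rewrite !inE (negPf gg).
by move=> /negbFE/asboolP.
Qed.

(** (0, k)-centrality, with each line named by any full vertex on it. *)
Definition central (k : 'I_n) (R : set (power A (vertex n))) :=
  forall gamma v, R gamma ->
    (forall f, off k v f -> gamma (upd k false f) = gamma (upd k true f)) ->
    gamma (upd k false v) = gamma (upd k true v).

Lemma extend_restrict (k : 'I_n) b (f : vertex n) :
  extend [ffun j : {j | j != k} => f (val j)] b = upd k b f.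
Proof.
apply/ffunP => j; rewrite updE ffunE; case: insubP => [u jk <-|].
  by rewrite ffunE (negPf (valP u)).
by rewrite negbK => ->.
Qed.

Lemma centrality_con0 (k : 'I_n) (R : set (power A (vertex n))) :
  centrality R (con0 A) k -> central k R.
Proof.
move=> /centralityP H gamma v Rg Hv.
have := H gamma [ffun j : {j | j != k} => v (val j)] Rg.
rewrite /line_in !extend_restrict; apply=> g gv.
pose f := extend g false; have <- : [ffun j : {j | j != k} => f (val j)] = g.
  by apply/ffunP => j; rewrite !ffunE valK.
rewrite !extend_restrict; apply: Hv.
have [j gj] : exists j, g j != v (val j).
  apply: contrapT => N; case/eqP: gv; apply/ffunP => j; rewrite ffunE.
  by apply/eqP/negPn/negP => gj; apply: N; exists j.
by exists (val j); [exact: (valP j)|rewrite ffunE valK].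
Qed.

End Centrality.

(** * Composition of relations on cubes *)

Section Composition.
Variables (S : signature) (A : algebra S) (n : nat).
Notation cubes := (power A (vertex n)).
Implicit Types (R : set cubes) (i k : 'I_n) (gamma : cubes).

Definition act k (h : bool -> bool) gamma : cubes :=
  fun f => gamma (upd k (h (f k)) f).

(** What M shares with its composites. The maps [h] of coordinate [k] give the identity, the
    reflection and the collapses onto either face. *)
Record rich R : Prop := Rich {
  rich_sub : subuniverse R;
  rich_cube : forall k x y, R (cube k x y);
  rich_act : forall k h gamma, R gamma -> R (act k h gamma)
}.

Definition glue k (g1 g2 : cubes) : cubes := fun f => if f k then g2 f else g1 f.

Definition comp k R : set cubes := [set gamma | exists g1 g2, [/\ R g1, R g2,
  forall f, g1 (upd k true f) = g2 (upd k false f) & gamma = glue k g1 g2]].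

Lemma sub_comp k R : rich R -> R `<=` comp k R.
Proof.
move=> rR gamma Rg; exists (act k (fun=> false) gamma), gamma; split=> //.
- exact: rich_act.
- by move=> f; rewrite /act upd_upd.
by apply/funext => f; rewrite /glue /act; case E: (f k); rewrite // -E upd_id.
Qed.

Lemma comp_mono k R1 R2 : R1 `<=` R2 -> comp k R1 `<=` comp k R2.
Proof. by move=> R12 g [g1 [g2 [/R12 ? /R12 ? ? ?]]]; exists g1, g2. Qed.

Lemma rich_comp k R : rich R -> rich (comp k R).
Proof.
move=> rR; split.
- move=> s a /choice [g1] /choice [g2] H.
  exists (op cubes s g1), (op cubes s g2); split.
  + by apply: rich_sub => // i; case: (H i).
  + by apply: rich_sub => // i; case: (H i).
  + by move=> f; congr (op A s _); apply/funext => i; case: (H i).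
  apply/funext => f; rewrite /glue /=.
  by case E: (f k); congr (op A s _); apply/funext => i; case: (H i) => _ _ _ ->;
    rewrite /glue E.
- by move=> i x y; apply: sub_comp => //; exact: rich_cube.
move=> i h _ [g1 [g2 [R1 R2 g12 ->]]].
case: (eqVneq i k) => [->|ik]; last first.
  exists (act i h g1), (act i h g2); split; try exact: rich_act.
    by move=> f; rewrite /act !updE (negPf ik) !(updC _ _ _ ik).
  apply/funext => f; rewrite /act /glue updE eq_sym (negPf ik).
  by case: (f k).
(* In order, [h] is constantly true, negation, the identity and constantly false; the reflection
   swaps the two factors. *)
case E0: (h false); case E1: (h true).
- exists (act k (fun=> true) g2), (act k (fun=> true) g2).
  split; try exact: rich_act.
    by move=> f; rewrite /act !upd_upd.
  by apply/funext => f; rewrite /act /glue upd_same; case: (f k); rewrite ?E0 ?E1.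
- exists (act k negb g2), (act k negb g1); split; try exact: rich_act.
    by move=> f; rewrite /act !upd_upd !upd_same.
  by apply/funext => f; rewrite /act /glue upd_same; case: (f k); rewrite ?E0 ?E1.
- exists g1, g2; split=> //; apply/funext => f; rewrite /act /glue upd_same.
  by case E: (f k); rewrite ?E0 ?E1 -E upd_id.
exists (act k (fun=> false) g1), (act k (fun=> false) g1).
split; try exact: rich_act.
  by move=> f; rewrite /act !upd_upd.
by apply/funext => f; rewrite /act /glue upd_same; case: (f k); rewrite ?E0 ?E1.
Qed.

(* Gluing [gamma] to its collapse in direction [i] turns an exceptional line in
   direction [i] into an exceptional line in direction [k]. *)
Lemma central_transfer i k R :
  i != k -> rich R -> central k (comp k R) -> central i R.
Proof.
move=> ik rR cR gamma v Rg Hv.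
pose b := v k.
(* The pieces meet in the face f_k = ~~ b of [gamma], where [Hv] makes all lines in direction [i]
   constant. *)
pose g1 := act k (fun x => if x then ~~ b else b) (act i (fun=> false) gamma).
pose g2 := act k (fun x => if x then b else ~~ b) gamma.
have glueE c f : glue k g1 g2 (upd k c f) =
    if c then gamma (upd k b f) else gamma (upd i false (upd k b f)).
  by rewrite /glue /g1 /g2 /act upd_same !upd_upd; case: c.
have vE c : upd i c (upd k b (upd i true v)) = upd i c v.
  by rewrite (updC _ _ _ ik) !upd_upd -(updC _ _ _ ik) upd_id.
have := cR (glue k g1 g2) (upd i true v) _ _; rewrite !glueE vE.
have -> : upd k b (upd i true v) = upd i true v.
  by rewrite -(updC _ _ _ ik) upd_id.
apply.
- exists g1, g2; split=> //.
  + by apply: rich_act => //; exact: rich_act.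
  + exact: rich_act.
  move=> f; rewrite /g1 /g2 /act !upd_upd !upd_same.
  have /Hv : off i v (upd k (~~ b) f).
    by exists k; rewrite 1?eq_sym // upd_same /b; case: (v k).
  by case E: (upd k (~~ b) f i) => H; [rewrite H|]; rewrite -E upd_id.
move=> f [j jk]; rewrite !glueE updE => fj.
case: (eqVneq j i) fj => [-> |ji] fj.
  have {}fj : upd k b f i = false by rewrite updE (negPf ik); case: (f i) fj.
  by rewrite -fj upd_id.
have /Hv H : off i v (upd k b f) by exists j => //; rewrite updE (negPf jk).
by case E: (upd k b f i); [rewrite H|]; rewrite -E upd_id.
Qed.

End Composition.

(** * Centrality of a composite from the Taylor identities *)

Section Transitivity.
Variables (S : signature) (A : algebra S) (n s : nat) (t : term S 'I_s).
Notation cubes := (power A (vertex n)).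
Hypothesis t_idem : forall x : A, eval (fun=> x) t = x.
Hypothesis t_taylor : forall e : 'I_s, exists z w : 'I_s -> bool,
  [/\ z e = false, w e = true &
      forall v : bool -> A, eval (v \o z) t = eval (v \o w) t].
Variables (k : 'I_n) (R : set cubes).
Hypotheses (richR : rich R) (cenR : central k R).

Definition lines (r r' : cubes) : cubes := fun f => if f k then r' f else r f.

(** The faces r0, r1, r2 of a composition are [r false], [r true], [r2], extended constantly in
    direction [k]; the boolean index lets the patterns z and w select r0 or r1. *)
Definition linked (v : vertex n) (b c : A) : Prop :=
  exists (r : bool -> cubes) (r2 : cubes),
   [/\ forall x y f, r x (upd k y f) = r x f,
       forall y f, r2 (upd k y f) = r2 f,
       forall x y, R (lines (r x) (r y)),
       R (lines (r true) r2) &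
       [/\ forall f, off k v f -> r false f = r2 f, r false v = b & r2 v = c]].

Lemma linked_translation v e w b c :
  linked v b c -> linked v (translation t e w b) (translation t e w c).
Proof.
move=> [r [r2 [ri r2i Rr Rr2 [rr rb r2c]]]].
have RC x : R (fun=> x).
  have <- : cube k x x = (fun=> x) by apply/funext => f; rewrite /cube if_same.
  exact: rich_cube.
pose tr (g : cubes) : cubes := fun f => translation t e w (g f).
have trR g g' : R (lines g g') -> R (lines (tr g) (tr g')).
  move=> Rg; have -> : lines (tr g) (tr g') =
      eval (fun j => if j == e then lines g g' else (fun=> w j) : cubes) t.
    apply/funext => f; rewrite eval_power /lines /tr /translation /plug.
    by case E: (f k); congr (eval _ t); apply/funext => j; case: (j == e);
      rewrite ?E.
  by apply: (subuniverse_eval _ (rich_sub richR)) => j; case: (j == e).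
exists (fun x => tr (r x)), (tr r2); split.
- by move=> x y f; rewrite /tr ri.
- by move=> y f; rewrite /tr r2i.
- by move=> x y; exact: trR.
- exact: trR.
by split; rewrite /tr ?rb ?r2c // => f /rr ->.
Qed.

Lemma linked_collapse v e b c :
  linked v b c -> exists u, translation t e u b = translation t e u c.
Proof.
move=> [r [r2 [ri r2i Rr Rr2 [rr rb r2c]]]].
have [z [w [ze we zw]]] := t_taylor e.
(* The face f_k = 0 is t(w(r0, r1)) = t(z(r0, r1)), with r0 in place e; the face f_k = 1 has r2
   there. Place e itself goes from r1 to r2, since w_e is true. *)
pose g : cubes := eval (fun j =>
  lines (r (w j)) (if j == e then r2 else r (z j)) : cubes) t.
have Rg : R g.
  apply: (subuniverse_eval _ (rich_sub richR)) => j.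
  by case: eqP => [->|_]; rewrite ?we.
have gE x f : g (upd k x f) = if x
    then translation t e (fun j => r (z j) f) (r2 f)
    else translation t e (fun j => r (z j) f) (r false f).
  rewrite /g eval_power /translation; case: x; last first.
    transitivity (eval ((fun x => r x f) \o w) t).
      by congr (eval _ t); apply/funext => j; rewrite /lines upd_same ri.
    rewrite -zw; congr (eval _ t); apply/funext => j.
    by rewrite /plug; case: eqP => [->|//] /=; rewrite ze.
  congr (eval _ t); apply/funext => j; rewrite /lines upd_same /plug.
  by case: eqP; rewrite ?r2i ?ri.
exists (fun j => r (z j) v); rewrite -rb -r2c.
have := cenR Rg (v := v); rewrite !gE; apply => f fv.
by rewrite !gE rr.
Qed.

(* Choosing, for every direction [j <> k], between an arbitrary tuple [w] and
   one that makes the corresponding translation collapse the pair, gives a cube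
   all of whose lines in direction [k] but one are constant. *)
Lemma collapsing_cube v b c (l : seq ('I_n * ('I_s * ('I_s -> A)))) :
  linked v b c -> all (fun p => p.1 != k) l ->
  linked v (translations t (map snd l) b) (translations t (map snd l) c) /\
  exists g : cubes, [/\ R g,
    forall f : vertex n, all (fun p => f p.1) l ->
      g f = translations t (map snd l) (if f k then c else b) &
    forall f : vertex n, ~~ all (fun p => f p.1) l ->
      g (upd k false f) = g (upd k true f)].
Proof.
move=> bc; elim: l => [_|[j [e w]] l IH /= /andP[jk lk]].
  split=> //; exists (cube k b c); split=> //; exact: rich_cube.
have {IH} [link [g [Rg gall gnall]]] := IH lk.
split; first exact: linked_translation.
have [u uE] := linked_collapse e link.
pose h i : cubes := if i == e then g else cube j (u i) (w i).
exists (eval h t); rewrite /h; split.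
- apply: (subuniverse_eval _ (rich_sub richR)) => i.
  by case: ifP => _ //; exact: rich_cube.
- move=> f /andP[fj fl]; rewrite eval_power /translation /plug.
  congr (eval _ t); apply/funext => i.
  by case: eqP => // _; rewrite ?gall // /cube fj.
move=> f; have upd_all x : all (fun p => upd k x f p.1) l = all (fun p => f p.1) l.
  move: lk; rewrite -!(all_map fst (fun j => _ j)) -(all_map fst (predC1 k)).
  by move=> /allP lk'; apply: eq_in_all => i /lk' /negPf ik; rewrite updE ik.
rewrite negb_and !eval_power.
case: (boolP (all (fun p => f p.1) l)) => fl; last first.
  move=> _; congr (eval _ t); apply/funext => i.
  by case: eqP => // _; rewrite ?gnall // /cube !updE (negPf jk).
rewrite orbF => fj.
have H x : eval (fun i => h i (upd k x f)) t
   = translation t e u (translations t (map snd l) (if x then c else b)).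
  rewrite /h /translation /plug; congr (eval _ t); apply/funext => i.
  case: eqP => // _; first by rewrite gall ?upd_all // upd_same.
  by rewrite /cube updE (negPf jk) (negPf fj).
by rewrite !H.
Qed.

Lemma linked_eq v b c : linked v b c -> b = c.
Proof.
(* One level of nesting for each direction other than [k]. *)
move=> bc; pose ds := [seq j <- enum 'I_n | j != k].
apply: (translations_separate (m := size ds) t_idem) => l sl.
pose l' := zip ds l.
have l2 : map snd l' = l by apply: unzip2_zip; rewrite sl.
have l1 : map fst l' = ds by apply: unzip1_zip; rewrite sl.
have allE (P : pred 'I_n) : all (fun p => P p.1) l' = all P ds.
  by rewrite -l1 all_map.
have lk : all (fun p => p.1 != k) l' by rewrite (allE (predC1 k)) filter_all.
have [_ [g [Rg gall gnall]]] := collapsing_cube bc lk.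
have one x : all (fun p => upd k x [ffun=> true] p.1) l'.
  rewrite (allE (fun j => upd k x [ffun=> true] j)).
  apply/allP => j; rewrite mem_filter updE ffunE => /andP[jk _].
  by rewrite (negPf jk).
(* The line through the all-ones vertex joins the two translated values; all others in direction [k]
   are constant. *)
have := cenR Rg (v := [ffun=> true]); rewrite !gall // !upd_same l2.
apply=> f [j jk fj]; apply: gnall; rewrite (allE (fun j => f j)).
apply/allPn; exists j; first by rewrite mem_filter jk mem_enum.
by move: fj; rewrite ffunE; case: (f j).
Qed.

Lemma central_comp : central k (comp k R).
Proof.
move=> _ v [g1 [g2 [R1 R2 g12 ->]]].
rewrite {3 4}/glue !upd_same => H.
apply: (linked_eq (v := v)).
pose r x : cubes := fun f => g1 (upd k x f).
exists r, (fun f => g2 (upd k true f)); split.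
- by move=> x y f; rewrite /r upd_upd.
- by move=> y f; rewrite upd_upd.
- move=> x y.
  have -> : lines (r x) (r y) = act k (fun b => if b then y else x) g1.
    by apply/funext => f; rewrite /lines /act /r; case: (f k).
  exact: rich_act.
- have -> // : lines (r true) (fun f => g2 (upd k true f)) = g2.
  apply/funext => f; rewrite /lines /r g12.
  by case E: (f k); rewrite -E upd_id.
split=> // f /H; by rewrite /glue !upd_same.
Qed.

End Transitivity.

(** * The matrices and their closure Delta under composition *)

Section Closure.
Variables (S : signature) (A : algebra S) (n : nat).
Notation cubes := (power A (vertex n)).
Notation M := (matrices (fun _ : 'I_n => con1 A)).
Implicit Types (k i : 'I_n) (l : seq 'I_n).

Lemma matrices_cube k x y : M (cube k x y).
Proof. by apply: sub_generated; exists k => //; exists x, y. Qed.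

(** Reindexing by [phi] commutes with the operations, so checking generators suffices. *)
Lemma matrices_closed (phi : vertex n -> vertex n) (gamma : cubes) :
  (forall k x y, M (fun f => cube k x y (phi f))) ->
  M gamma -> M (fun f => gamma (phi f)).
Proof.
move=> Hphi; move: gamma.
apply: (generated_sub (B := [set gamma : cubes | M (fun f => gamma (phi f))])).
  move=> s a Ha; exact: (generated_subuniverse Ha).
by move=> _ [k _ [x [y [_ ->]]]]; exact: Hphi.
Qed.

Lemma rich_matrices : rich M.
Proof.
split=> [|k x y|k h gamma]; first exact: generated_subuniverse.
  exact: matrices_cube.
apply: matrices_closed => i x y.
case: (eqVneq i k) => [->|ik].
  have -> : (fun f : vertex n => cube k x y (upd k (h (f k)) f)) =
      cube k (if h false then y else x) (if h true then y else x).
    by apply/funext => f; rewrite /cube upd_same; case: (f k).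
  exact: matrices_cube.
have -> : (fun f : vertex n => cube i x y (upd k (h (f k)) f)) = cube i x y.
  by apply/funext => f; rewrite /cube updE (negPf ik).
exact: matrices_cube.
Qed.

(** All arguments of M are equal, so M is invariant under transposing two directions. *)
Lemma central_matrices k i : central k M -> central i M.
Proof.
pose p := tperm i k; pose phi (f : vertex n) : vertex n := [ffun j => f (p j)].
have phi_upd b f : phi (upd k b f) = upd i b (phi f).
  by apply/ffunP => j; rewrite !ffunE -(inj_eq (@perm_inj _ p) j) tpermL.
have phiK f : phi (phi f) = f.
  by apply/ffunP => j; rewrite !ffunE tpermK.
move=> cM gamma v Mg Hv.
have := cM (fun f => gamma (phi f)) (phi v); rewrite !phi_upd phiK; apply.
  apply: matrices_closed Mg => j x y.
  have -> : (fun f => cube j x y (phi f)) = cube (p j) x y.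
    by apply/funext => f; rewrite /cube ffunE.
  exact: matrices_cube.
move=> f [j jk fj]; rewrite !phi_upd; apply: Hv; exists (p j).
  by rewrite -[X in _ != X](tpermR i k) (inj_eq (@perm_inj _ p)).
by move: fj; rewrite !ffunE tpermK.
Qed.

Definition stage l : set cubes := foldr (@comp S A n) M l.

(** A directed union: [stage (l1 ++ l2)] contains [stage l1] and [stage l2]. *)
Definition delta : set cubes := [set gamma | exists l, stage l gamma].

Lemma rich_stage l : rich (stage l).
Proof. by elim: l => [|k l IH]; [exact: rich_matrices|exact: rich_comp]. Qed.

Lemma stage_catl l1 l2 : stage l2 `<=` stage (l1 ++ l2).
Proof.
elim: l1 => [|k l1 IH] //= g /IH Hg; apply: sub_comp => //; exact: rich_stage.
Qed.

Lemma stage_catr l1 l2 : stage l1 `<=` stage (l1 ++ l2).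
Proof.
elim: l1 => [|k l1 IH] /=; last exact: comp_mono.
by have := @stage_catl l2 [::]; rewrite cats0.
Qed.

Lemma delta_comp k : comp k delta `<=` delta.
Proof.
move=> _ [g1 [g2 [[l1 g1l] [l2 g2l] g12 ->]]].
exists (k :: l1 ++ l2), g1, g2; split=> //.
  exact: stage_catr.
exact: stage_catl.
Qed.

Lemma rich_delta : rich delta.
Proof.
split=> [s a /choice[l al]|k x y|k h gamma [l gl]].
(* Operations are finitary, so one stage contains all arguments. *)
- exists (flatten [seq l j | j <- enum 'I_(arity s)]).
  apply: (rich_sub (rich_stage _)) => j.
  have : j \in enum 'I_(arity s) by rewrite mem_enum.
  case/splitPr => p1 p2; rewrite map_cat flatten_cat /=.
  by apply: stage_catl; apply: stage_catr.
- by exists [::]; exact: matrices_cube.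
by exists l; apply: rich_act => //; exact: rich_stage.
Qed.

Lemma central_delta k i : taylor A -> central k M -> central i delta.
Proof.
move=> [s [t [t_idem t_taylor]]] cM gamma v [l].
suff: central i (stage l) by apply.
elim: l i => [|j l IH] i /=; first exact: central_matrices cM.
have rl := rich_stage l; have cj := central_comp t_idem t_taylor rl (IH j).
case: (eqVneq i j) => [->|ij] //.
(* The transfer requires centrality after a further composition in direction [j]. *)
apply: (central_transfer ij); first exact: rich_comp.
by apply: (central_comp t_idem t_taylor) => //; exact: rich_comp.
Qed.

(** * The congruences delta_k *)

Definition corner (k : nat) (x y : A) : cubes :=
  fun f => if all_below k f then y else x.

(** Collapsing onto the face f_m = 1 turns [corner m.+1] into [corner m]. *)
Lemma corner_weak (k m : nat) x y :
  k <= m <= n -> delta (corner m x y) -> delta (corner k x y).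
Proof.
move=> /andP[]; elim: m => [|m IH]; first by rewrite leqn0 => /eqP->.
rewrite leq_eqVlt => /orP[/eqP->|km mn dm] //; apply: IH => //; first exact: ltnW.
have := rich_act rich_delta (Ordinal mn) (fun=> true) dm.
have -> // : act (Ordinal mn) (fun=> true) (corner m.+1 x y) = corner m x y.
apply/funext => f; rewrite /act /corner (all_belowS (Ordinal mn)) upd_same.
by rewrite andbT all_below_upd.
Qed.


(* The cube with value [y] on the face [f_0 = ... = f_(j-1) = 1] and [x] outside,
   except for the value [z] on the subface of codimension [k]: for [j] from [0]
   to [k] it interpolates between [corner k y z] and [corner k x z]. *)
Definition nested_corner (j k : nat) (x y z : A) : cubes :=
  fun f => if all_below j f then corner k y z f else x.

Lemma nested_corner_step (j k : nat) x y z : j < k <= n -> delta (corner j.+1 x y) ->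
  delta (nested_corner j k x y z) <-> delta (nested_corner j.+1 k x y z).
Proof.
move=> /andP[jk kn] dj; have jn := leq_trans jk kn.
pose i := Ordinal jn.
have cornerE b f : corner j.+1 x y (upd i b f) =
    if all_below j f && b then y else x.
  by rewrite /corner (all_belowS i) upd_same all_below_upd.
have jE b f : nested_corner j k x y z (upd i b f) =
    if all_below j f then corner k y z (upd i b f) else x.
  by rewrite /nested_corner all_below_upd.
have jSE b f : nested_corner j.+1 k x y z (upd i b f) =
    if all_below j f && b then corner k y z (upd i b f) else x.
  by rewrite /nested_corner (all_belowS i) upd_same all_below_upd.
(* As j < k, the face f_j = 0 avoids the value z, so that of [nested_corner j] equals the face f_j =
   1 of [corner j.+1]. *)
have kE f : corner k y z (upd i false f) = y.
  rewrite /corner; case: ifP => // /(all_below_weak jk).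
  by rewrite (all_belowS i) upd_same andbF.
split=> dn; apply: (delta_comp (k := i)).
  exists (corner j.+1 x y), (nested_corner j k x y z); split=> //.
    by move=> f; rewrite cornerE jE kE andbT.
  apply/funext => f; rewrite -(upd_id i f) /glue upd_same jSE cornerE jE.
  by case: (f i); rewrite ?andbT ?andbF.
exists (act i negb (corner j.+1 x y)), (nested_corner j.+1 k x y z); split=> //.
- exact: (rich_act rich_delta).
- by move=> f; rewrite /act upd_same upd_upd cornerE jSE andbF.
apply/funext => f; rewrite -(upd_id i f) /glue upd_same /act upd_upd upd_same.
rewrite jSE cornerE jE.
by case: (f i); rewrite ?andbT ?andbF // kE.
Qed.

Lemma corner_shift (k : nat) x y z : k <= n -> delta (corner k x y) ->
  delta (corner k y z) <-> delta (corner k x z).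
Proof.
move=> kn dxy.
have -> : corner k x z = nested_corner k k x y z.
  by apply/funext => f; rewrite /nested_corner /corner; case: (all_below k f).
have -> : corner k y z = nested_corner 0 k x y z.
  by apply/funext => f; rewrite /nested_corner all_below0.
have H j : j <= k ->
    delta (nested_corner 0 k x y z) <-> delta (nested_corner j k x y z).
  elim: j => // j IH jk; rewrite IH 1?ltnW //.
  apply: nested_corner_step; first by rewrite jk.
  by apply: (corner_weak _ dxy); rewrite jk.
exact: H.
Qed.

Lemma corner_refl (i : 'I_n) (k : nat) x : delta (corner k x x).
Proof.
have -> : corner k x x = cube i x x.
  by apply/funext => f; rewrite /corner /cube !if_same.
exact: rich_cube rich_delta _ _ _.
Qed.

(** The index [i] witnesses n > 0, which makes constant cubes available for reflexivity. *)
Definition corner_con (i : 'I_n) (k : nat) (kn : k <= n) : congruence A.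
Proof.
refine (@Congruence S A (fun x y => delta (corner k x y)) _ _ _ _).
- by move=> x; exact: corner_refl.
- by move=> x y xy; apply/(corner_shift _ kn xy); exact: corner_refl.
- by move=> x y z xy yz; apply/(corner_shift _ kn xy).
move=> s a b ab.
have -> : corner k (op A s a) (op A s b) =
    op cubes s (fun j => corner k (a j) (b j)).
  by apply/funext => f; rewrite /corner /=; case: (all_below k f).
exact: (rich_sub rich_delta).
Defined.

(** M(1, beta) has (delta_(k+1), 1)-centrality: a matrix with lines (a, b) and (c, d) is spread over
    the n-cube, and compositions in direction [k] turn the corner of (a, b) into that of (c, d). *)
Lemma commutator_corner (i k : 'I_n) (beta : congruence A) :
  con_le beta (corner_con i (ltnW (ltn_ord k))) ->
  con_le (tc_commutator2 (con1 A) beta) (corner_con i (ltn_ord k)).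
Proof.
move=> bk x y; apply; apply/centralityP => gamma g0 Mg Hg.
pose g1 : line_index (ord_max : 'I_2) := [ffun j => ~~ g0 j].
have := Hg g1; rewrite /line_in /=.
set a := gamma (extend g1 false); set b := gamma (extend g1 true).
set c := gamma (extend g0 false); set d := gamma (extend g0 true).
have g10 : g1 != g0.
  have j : {j : 'I_2 | j != ord_max} by exists ord0.
  by apply/eqP => /ffunP/(_ j); rewrite ffunE; case: (g0 j).
move=> /(_ g10) dab.
(* [f k] selects the line and [all_below k f] the place on it: generators in direction 0 become
   cubes in direction [k], those in direction 1 become corners, which lie in Delta by [bk]. *)
pose h (f : vertex n) : vertex 2 :=
  extend (if f k then g0 else g1) (all_below k f).
have dh : delta (fun f => gamma (h f)).
  move: gamma Mg {Hg a b c d dab}.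
  apply: (generated_sub
    (B := [set gamma : power A (vertex 2) | delta (fun f => gamma (h f))])).
    by move=> s u Hu; exact: (rich_sub rich_delta Hu).
  move=> _ [j _ [u [w [uw ->]]]] /=.
  case: (eqVneq j ord_max) uw => [-> /= /bk|jm _].
    congr delta; apply/funext => f.
    by rewrite /cube /h /corner /extend ffunE; case: insubP; rewrite ?eqxx.
  have -> : (fun f => cube j u w (h f)) =
      cube k (if extend g1 false j then w else u)
        (if extend g0 false j then w else u).
    apply/funext => f; rewrite /cube /h /extend; case: (f k); rewrite !ffunE;
    by case: insubP => //; rewrite jm.
  exact: (rich_cube rich_delta).
have hE e f : gamma (h (upd k e f)) = if e
    then if all_below k f then d else c else if all_below k f then b else a.
  by rewrite /h upd_same all_below_upd //; case: e; case: ifP.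
have cornerE e z z' f :
    corner k.+1 z z' (upd k e f) = if all_below k f && e then z' else z.
  by rewrite /corner all_belowS upd_same all_below_upd.
(* Gluing [corner k.+1 a b] in front makes the face f_k = 0 constantly a; gluing [cube k c a] in
   front of that makes it constantly c. *)
pose g : cubes := fun f => if f k then if all_below k f then d else c else a.
have gE e f : g (upd k e f) = if e then if all_below k f then d else c else a.
  by rewrite /g upd_same all_below_upd.
have dg : delta g.
  apply: (delta_comp (k := k)).
  exists (corner k.+1 a b), (fun f => gamma (h f)); split=> //.
    by move=> f; rewrite cornerE hE andbT.
  apply/funext => f; rewrite -(upd_id k f) /glue upd_same gE hE cornerE.
  by case: (f k); rewrite ?andbF.
apply: (delta_comp (k := k)); exists (cube k c a), g; split=> //.
- exact: (rich_cube rich_delta).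
- by move=> f; rewrite /cube gE upd_same.
apply/funext => f; rewrite -(upd_id k f) /glue upd_same gE cornerE /cube upd_same.
by case: (f k); rewrite ?andbF ?andbT.
Qed.

Lemma left_series_corner (i : 'I_n) (k : nat) (kn : k <= n) :
  con_le (left_series (con1 A) k) (corner_con i kn).
Proof.
elim: k kn => [|k IH] kn.
  move=> x y _ /=; have -> : corner 0 x y = cube i y y.
    by apply/funext => f; rewrite /corner all_below0 /cube if_same.
  exact: (rich_cube rich_delta).
have := @commutator_corner i (Ordinal kn) (left_series (con1 A) k).
by move=> /(_ (IH _)) H x y /H.
Qed.

(** All lines of [corner n x y] in direction [k] are constant except the one through the all-ones
    vertex, which goes from x to y. *)
Lemma central_corner (k : 'I_n) x y :
  central k delta -> delta (corner n x y) -> x = y.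
Proof.
move=> cd dxy; have := cd _ [ffun=> true] dxy.
have cornerE f : corner n x y f = if [forall j, f j] then y else x.
  rewrite /corner; congr (if _ then _ else _).
  by apply: eq_forallb => j; rewrite ltn_ord.
rewrite !cornerE.
have -> : [forall j, upd k false [ffun=> true] j] = false.
  by apply/negP => /forallP/(_ k); rewrite upd_same.
have -> : [forall j, upd k true [ffun=> true] j].
  by apply/forallP => j; rewrite updE ffunE if_same.
apply=> f [j jk fj]; rewrite !cornerE.
have fE b : [forall j, upd k b f j] = false.
  apply/negP => /forallP/(_ j); rewrite updE (negPf jk).
  by move: fj; rewrite ffunE => /negPf; case: (f j).
by rewrite !fE.
Qed.

End Closure.

(** * From centrality of Delta to nilpotence *)

Theorem theorem4p15 (S : signature) (A : algebra S) :
  taylor A -> supernilpotent A -> nilpotent A.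
Proof.
move=> tA [m E]; exists m.+2; apply: con_ext => x y; split=> [xy|->]; last first.
  exact: con_refl.
have c0 : centrality (matrices (fun _ : 'I_m.+2 => con1 A)) (con0 A) ord_max.
  (* By [E], 0 is the meet of all congruences for which M has centrality, and centrality passes to
     meets. *)
  rewrite -E; apply/centralityP => gamma g0 Mg Hg d Dd.
  move: (Dd) => /centralityP; apply=> // g /Hg; exact.
have cd := central_delta (i := ord_max) tA (centrality_con0 c0).
by apply: (central_corner cd); apply: (left_series_corner ord0 (leqnn _) xy).
Qed.
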